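(* Let $F:[0,1]\to2^{[0,1]}$ be a properly parametrized Markov multi-map, and let $$W=\bigcap_{n=1}^\infty F^n([0,1]).$$ If the inverse limit system $(Y(F),S)$ is topologically transitive, then the forward trajectory system $(X(F|_W),T)$ is topologically transitive.
   Context: **Markov multi-maps.** $2^{[0,1]}$ denotes the set of closed subsets of $[0,1]$. A Markov multi-map of $[0,1]$ is given by a tuple $F=(P,\mathcal{A}_0,\mathcal{A}_1,\mathcal{A}_2,D,R,\{f_a\}_{a\in\mathcal{A}_0})$ such that: (1) $P=\{p_0,\dots,p_r\}$ with $0=p_0<\dots<p_r=1$; (2) $\mathcal{A}=\mathcal{A}_0\sqcup\mathcal{A}_1\sqcup\mathcal{A}_2$ is a finite set; (3) $D:\mathcal{A}\to 2^{[0,1]}$, and for each $a\in\mathcal{A}$ there is $p_i\in P$ with $D(a)=[p_i,p_{i+1}]$ if $a\in\mathcal{A}_0$ and $D(a)=\{p_i\}$ if $a\in\mathcal{A}_1\cup\mathcal{A}_2$; (4) $R:\mathcal{A}\to 2^{[0,1]}$, and for each $a\in\mathcal{A}$ there are $u\le v$ in $P$ with $R(a)=[u,v]$, where $u<v$ if $a\in\mathcal{A}_0$; $u<v$ and $R(a)\cap P=\{u,v\}$ if $a\in\mathcal{A}_1$; $u=v$ if $a\in\mathcal{A}_2$; (5) for each $a\in\mathcal{A}_0$, $f_a:D(a)\to R(a)$ is a homeomorphism; (6) $[0,1]=\bigcup_{a\in\mathcal{A}}D(a)$. For $a\in\mathcal{A}_0$ let $G(a)$ be the graph of $f_a$; for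 $a\in\mathcal{A}_1\cup\mathcal{A}_2$ let $G(a)=D(a)\times R(a)$. The multi-map $F:[0,1]\to 2^{[0,1]}$ has graph $G(F)=\bigcup_{a\in\mathcal{A}}G(a)$, i.e. $y\in F(x)$ iff $(x,y)\in G(F)$. If $a\in\mathcal{A}_0$ with $D(a)=[p_i,p_{i+1}]$, let $G_0(a)$ be the graph of $f_a|_{(p_i,p_{i+1})}$; if $a\in\mathcal{A}_1$ with $D(a)=\{p\}$, $R(a)=[u,v]$, let $G_0(a)=\{p\}\times(u,v)$; if $a\in\mathcal{A}_2$ with $D(a)=\{p\}$, $R(a)=\{q\}$, let $G_0(a)=\{(p,q)\}$. $F$ is properly parametrized if $\{G_0(a):a\in\mathcal{A}\}$ is a partition of $G(F)$. **Iterates.** For $B\subset[0,1]$, $F(B)=\bigcup_{x\in B}F(x)$, $F^1(B)=F(B)$ and $F^{n}(B)=F(F^{n-1}(B))$. **Systems.** $Y(F)=\{y\in[0,1]^{\mathbb{Z}_{\le0}}:y_{k+1}\in F(y_k)\ \forall k\le-1\}$ with $S(y)_k=y_{k-1}$. $F|_W$ is the restriction of $F$ to $W$ (one has $F(W)=W$), and $X(F|_W)=\{x\in W^{\mathbb{Z}_{\ge0}}:x_{k+1}\in F(x_k)\ \forall k\ge0\}$ with $T(x)_k=x_{k+1}$. Both spaces carry the subspace topology of the product topology. A system $(Z,f)$ is topologically transitive if for all nonempty open $U,V\subset Z$ there is $n\ge0$ with $f^n(U)\cap V\ne\emptyset$. *)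

(* Defs.v *)
From HB Require Import structures.
From mathcomp Require Import all_boot all_order all_algebra.
From mathcomp Require Import all_classical all_reals all_analysis.
Import Order.TTheory GRing.Theory Num.Theory.
Import numFieldNormedType.Exports.

Set Implicit Arguments.
Unset Strict Implicit.
Unset Printing Implicit Defensive.

Local Open Scope classical_set_scope.
Local Open Scope ring_scope.

Definition homeo_on (T U : topologicalType) (A : set T) (B : set U)
    (f : T -> U) : Prop :=
  exists g : U -> T,
    [/\ set_fun A B f, set_fun B A g,
        {in A, cancel f g} & {in B, cancel g f}] /\
    {within A, continuous f} /\ {within B, continuous g}.

(* Only the values [mm_pt i] with [i <= mm_r] are used: they are the points of
   the finite set P. Likewise, only the restriction of [mm_f a] to the domain
   of [a] matters. *)
Record markov_multimap (R : realType) : Type := MarkovMultimap {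
  mm_r : nat;
  mm_pt : nat -> R;
  mm_A0 : finType;
  mm_A1 : finType;
  mm_A2 : finType;
  mm_D : mm_A0 + mm_A1 + mm_A2 -> set R;
  mm_R : mm_A0 + mm_A1 + mm_A2 -> set R;
  mm_f : mm_A0 -> R -> R;
  mm_P := [set mm_pt i | i in [set i | (i <= mm_r)%N]];
  mm_pt_first : mm_pt 0 = 0;
  mm_pt_last : mm_pt mm_r = 1;
  mm_pt_lt : forall i, (i < mm_r)%N -> mm_pt i < mm_pt i.+1;
  mm_D0P : forall a : mm_A0, exists2 i, (i < mm_r)%N &
    mm_D (inl (inl a)) = `[mm_pt i, mm_pt i.+1]%classic;
  mm_D1P : forall a : mm_A1, exists2 p, mm_P p & mm_D (inl (inr a)) = [set p];
  mm_D2P : forall a : mm_A2, exists2 p, mm_P p & mm_D (inr a) = [set p];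
  mm_R0P : forall a : mm_A0, exists u v,
    [/\ mm_P u, mm_P v, u < v & mm_R (inl (inl a)) = `[u, v]%classic];
  mm_R1P : forall a : mm_A1, exists u v,
    [/\ mm_P u, mm_P v, u < v, mm_R (inl (inr a)) = `[u, v]%classic &
        mm_R (inl (inr a)) `&` mm_P = [set u; v]];
  mm_R2P : forall a : mm_A2, exists2 u, mm_P u & mm_R (inr a) = `[u, u]%classic;
  mm_fP : forall a : mm_A0,
    homeo_on (mm_D (inl (inl a))) (mm_R (inl (inl a))) (mm_f a);
  mm_cover : `[0, 1]%classic = \bigcup_a mm_D a
}.

Section MultiMap.
Variables (R : realType) (F : markov_multimap R).

Definition mm_idx : Type := (mm_A0 F + mm_A1 F + mm_A2 F)%type.

Definition mm_G (a : mm_idx) : set (R * R) :=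
  match a with
  | inl (inl b) => [set z | mm_D a z.1 /\ z.2 = mm_f b z.1]
  | _ => mm_D a `*` mm_R a
  end.

Definition mm_graph : set (R * R) := \bigcup_a mm_G a.

Definition mm_G0 (a : mm_idx) : set (R * R) :=
  match a with
  | inl (inl b) =>
      [set z | exists i, [/\ (i < mm_r F)%N,
         mm_D a = `[mm_pt F i, mm_pt F i.+1]%classic,
         mm_pt F i < z.1 < mm_pt F i.+1 & z.2 = mm_f b z.1]]
  | inl (inr _) =>
      [set z | exists u v,
         mm_R a = `[u, v]%classic /\ (mm_D a `*` `]u, v[%classic) z]
  | inr _ => mm_D a `*` mm_R a
  end.

(* The family is taken as a set of sets: its blocks are the elements of the
   range of [mm_G0]. *)
Definition properly_parametrized : Prop :=
  partition (range mm_G0) id mm_graph.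

Definition mm_val (x : R) : set R := [set y | mm_graph (x, y)].

End MultiMap.

Section Systems.
Variable R : realType.
Implicit Types (F : R -> set R) (B W : set R).

Definition multi_image F B : set R := \bigcup_(x in B) F x.

Definition eventual_range F : set R :=
  \bigcap_(n in [set n | (1 <= n)%N]) iter n (multi_image F) `[0, 1]%classic.

(* The coordinate y_(-k), k >= 0, of a point of the inverse limit is stored at
   the index k of the sequence; hence y_(j+1) \in F(y_j) for j <= -1 reads as
   y k \in F (y k.+1), and the shift k |-> y_(k-1) as k |-> y k.+1. *)
Definition inverse_limit F : set ({ptws nat -> R}) :=
  [set y | (forall k, `[0, 1]%classic (y k)) /\ (forall k, F (y k.+1) (y k))].

Definition forward_trajectories F W : set ({ptws nat -> R}) :=
  [set x | (forall k, W (x k)) /\ (forall k, F (x k) (x k.+1))].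

Lemma inverse_limit_shift F (y : inverse_limit F) :
  (fun k : nat => set_val y k.+1) \in inverse_limit F.
Proof.
by have /set_mem[y01 yF] := valP y; apply/mem_set; split=> k; [exact: y01|exact: yF].
Qed.

Lemma forward_trajectories_shift F W (x : forward_trajectories F W) :
  (fun k : nat => set_val x k.+1) \in forward_trajectories F W.
Proof.
by have /set_mem[xW xF] := valP x; apply/mem_set; split=> k; [exact: xW|exact: xF].
Qed.

Definition inverse_limit_map F (y : inverse_limit F) : inverse_limit F :=
  exist (fun z => z \in inverse_limit F) _ (inverse_limit_shift y).

Definition forward_map F W (x : forward_trajectories F W) :
    forward_trajectories F W :=
  exist (fun z => z \in forward_trajectories F W) _
    (forward_trajectories_shift x).

End Systems.

Definition topologically_transitive (Z : topologicalType) (f : Z -> Z) : Prop :=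
  forall U V : set Z, open U -> open V -> U !=set0 -> V !=set0 ->
    exists n : nat, (iter n f @` U) `&` V !=set0.

(* Main.v *)
(** [W] is the set of points with an infinite past: this is where compactness
    of the graph enters.  Hence the reversed initial segments of points of
    [X(F|_W)] are exactly the final segments of points of [Y(F)].  Given
    cylinders [U] and [V] of [X(F|_W)], transitivity of [S] yields a point of
    [Y(F)] whose final segment matches [V] and in which a segment [n] steps
    earlier matches [U]; reading it forward from that earlier segment, and
    prolonging it by any forward orbit, gives a point of [U] that [T^n] maps
    into [V]. *)
Require Import Defs.
From mathcomp Require Import all_boot all_order all_algebra.
From mathcomp Require Import all_classical all_reals all_analysis.

Import numFieldNormedType.Exports.
Import Order.TTheory GRing.Theory Num.Theory.

Local Open Scope classical_set_scope.
Local Open Scope ring_scope.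

(** * Cylinders in the product topology *)

(** Boxes around [x] generate a filter; the product topology is a supremum of coordinate topologies,
    so convergence of this filter to [x] is checked one coordinate at a time. *)
Lemma nbhs_ptws_box (T : topologicalType) (x : {ptws nat -> T})
    (O : set {ptws nat -> T}) :
  nbhs x O -> exists m (N : nat -> set T),
    (forall k, open_nbhs (x k) (N k)) /\
    (forall z : nat -> T, (forall k, (k <= m)%N -> N k (z k)) -> O z).
Proof.
pose D := [set mN : nat * (nat -> set T) |
  forall k, open_nbhs (x k) (mN.2 k)].
pose box (mN : nat * (nat -> set T)) : set {ptws nat -> T} :=
  [set z | forall k, (k <= mN.1)%N -> mN.2 k (z k)].
have boxF : Filter (filter_from D box).
  apply: filter_from_filter.
    by exists (0, fun=> setT) => k; exact: open_nbhsT.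
  move=> [m M] [n N] DM DN; exists (maxn m n, fun k => M k `&` N k).
    by move=> k; apply: open_nbhsI; [exact: DM|exact: DN].
  move=> z zMN; split=> k /= km; have [] := zMN k _ => //=.
    by rewrite leq_max km.
  by rewrite leq_max km orbT.
suff /[apply] -[[m N] DN NO] : filter_from D box --> x.
  by exists m, N; split=> // z zN; exact: NO.
apply/cvg_sup => i U [_ [[A oA <-] Ax AU]].
(* The side is [A] at coordinate [i] and the whole space elsewhere. *)
exists (i, fun k => [set t | k = i -> A t]).
  move=> k; split=> /=; last by move=> ->.
  have [->|ki] := pselect (k = i).
    by rewrite [X in open X](_ : _ = A)//; apply/seteqP; split=> t //=; exact.
  rewrite [X in open X](_ : _ = setT); first exact: openT.
  by apply/seteqP; split=> // t _ /ki.
by move=> z zA; apply: AU; exact: (zA i).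
Qed.

Lemma open_ptws_box (T : topologicalType) (m : nat) (N : nat -> set T) :
  (forall k, open (N k)) ->
  open [set z : {ptws nat -> T} | forall k, (k <= m)%N -> N k (z k)].
Proof.
move=> oN; rewrite openE => z zN.
suff : nbhs z [set z' : {ptws nat -> T} | forall k : 'I_m.+1, N k (z' k)].
  by apply: filterS => z' zN' k km; exact: (zN' (Ordinal (km : (k < m.+1)%N))).
apply: (@filter_forall _ _ (fun k : 'I_m.+1 => [set z' | N k (z' k)])
  (nbhs z)) => k.
apply: (@proj_continuous nat (fun=> T) k z).
by apply: open_nbhs_nbhs; split=> //; apply: zN; rewrite -ltnS.
Qed.

(** * Compact relations and infinite pasts *)

Lemma compact_multi_image (R : realType) (f : R -> set R) (B : set R) :
  compact [set z : R * R | f z.1 z.2] -> closed B -> compact (multi_image f B).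
Proof.
move=> Gf cB.
have -> : multi_image f B =
    snd @` ([set z : R * R | f z.1 z.2] `&` (fst @^-1` B)).
  apply/seteqP; split=> [y [x Bx fxy]|_ [[x y] [fxy Bx] <-]]; last by exists x.
  by exists (x, y).
apply: continuous_compact.
  by apply: continuous_subspaceT => z; exact: cvg_snd.
apply: compact_closedI => //; apply: preimage_closed cB.
by move=> z _; exact: cvg_fst.
Qed.

(** Choose a preimage of [w] in each iterate [A n]. A cluster point of these lies in every [A n], as
    the [A n] are closed and decreasing, and is again a preimage because the graph is closed. *)
Lemma preimage_in_eventual_range (R : realType) (f : R -> set R) (w : R) :
  compact [set z : R * R | f z.1 z.2] ->
  (forall x y, f x y -> `[0, 1]%classic y) ->
  eventual_range f w -> exists2 v, eventual_range f v & f v w.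
Proof.
move=> Gf f01 Ww.
pose A n := iter n (multi_image f) `[0, 1]%classic.
have AS n : A n.+1 `<=` A n.
  elim: n => [y [x _ fxy]|n IH y [x Ax fxy]]; first exact: f01 fxy.
  by exists x => //; exact: IH.
have Ale m n : (m <= n)%N -> A n `<=` A m.
  by move=> /subnK <-; elim: (n - m)%N => // k IH y /AS/IH.
have cA n : closed (A n).
  elim: n => [|n IH]; first exact: interval_closed.
  by apply: compact_closed; [exact: Rhausdorff|exact: compact_multi_image].
have /choice[v vP] : forall n, exists v, A n v /\ f v w.
  by move=> n; have [v Av fvw] := Ww n.+1 isT; exists v.
have v01 : \forall n \near \oo, `[0, 1]%classic (v n).
  by apply: nearW => n; apply: (Ale 0) (vP n).1.
have [u [_ clu]] := @segment_compact R 0 1 (v @ \oo) _ v01.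
have inC C : closed C -> (\forall n \near \oo, C (v n)) -> C u.
  by move=> cC vC; rewrite (closure_id C).1// => B /(clu _ _ vC).
exists u; last first.
  apply: (inC (fun x => f x w)); last by apply: nearW => n; exact: (vP n).2.
  have cG := compact_closed (@norm_hausdorff _ _) Gf.
  apply: (@preimage_closed _ _ (fun x : R => (x, w)) _ _ cG) => x _.
  exact: (cvg_pair cvg_id (cvg_cst w)).
move=> n _; apply: (inC (A n)) => //; exists n => // m /= nm.
exact: (Ale _ _ nm) (vP m).1.
Qed.

Lemma eventual_range_past (R : realType) (f : R -> set R) (w : R) :
  compact [set z : R * R | f z.1 z.2] ->
  (forall x y, f x y -> `[0, 1]%classic y) ->
  eventual_range f w ->
  exists y : nat -> R, y 0%N = w /\ inverse_limit f y.
Proof.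
move=> Gf f01 Ww.
(* Choosing inside the subtype keeps every predecessor in the eventual range, so that it has a
   predecessor there too. *)
pose W := {v | eventual_range f v}.
have step (v : W) : {u : W | f (sval u) (sval v)}.
  apply: cid.
  have [u Wu fuv] := preimage_in_eventual_range _ _ _ Gf f01 (svalP v).
  by exists (exist _ u Wu).
have [y [y0 yS]] := dependent_choice step (exist _ w Ww).
exists (sval \o y); split; first by rewrite /= y0.
by split=> k; [exact: f01 (yS k)|exact: yS].
Qed.

Lemma image_in_eventual_range (R : realType) (f : R -> set R) (x y : R) :
  (forall x y, f x y -> `[0, 1]%classic y) ->
  eventual_range f x -> f x y -> eventual_range f y.
Proof.
(* The intersection starts at iterate 1, so [x] in [[0, 1]] has to be recovered from its being a
   value of [f]. *)
move=> f01 Wx fxy [//|[|n]] _; exists x => //; last exact: Wx.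
by have [t _ ftx] := Wx 1%N isT; exact: f01 ftx.
Qed.

Lemma inverse_limit_eventual_range (R : realType) (f : R -> set R)
    (y : nat -> R) k :
  inverse_limit f y -> eventual_range f (y k).
Proof.
move=> [y01 yf] n _; elim: n k => [|n IH] k; first exact: y01.
by exists (y k.+1).
Qed.

(** * Transfer of transitivity *)

Lemma iter_inverse_limit_map (R : realType) (f : R -> set R) n
    (y : inverse_limit f) k :
  set_val (iter n (@inverse_limit_map R f) y) k = set_val y (k + n)%N.
Proof.
elim: n k => [|n IH] k; first by rewrite addn0.
by rewrite iterS -[LHS]/(set_val (iter n _ y) k.+1) IH addSnnS.
Qed.

Lemma iter_forward_map (R : realType) (f : R -> set R) (W : set R) n
    (x : forward_trajectories f W) k :
  set_val (iter n (@forward_map R f W) x) k = set_val x (k + n)%N.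
Proof.
elim: n k => [|n IH] k; first by rewrite addn0.
by rewrite iterS -[LHS]/(set_val (iter n _ x) k.+1) IH addSnnS.
Qed.

(** Compactness of the graph supplies pasts; nonempty values on [[0, 1]] supply futures. *)
Lemma transitive_inverse_limit_forward (R : realType) (f : R -> set R) :
  compact [set z : R * R | f z.1 z.2] ->
  (forall x y, f x y -> `[0, 1]%classic y) ->
  (forall x, `[0, 1]%classic x -> exists y, f x y) ->
  topologically_transitive (@inverse_limit_map R f) ->
  topologically_transitive (@forward_map R f (eventual_range f)).
Proof.
move=> Gf f01 f_total trY U V oU oV [x Ux] [x' Vx'].
have reversal (O : set (forward_trajectories f (eventual_range f))) z :
    open O -> O z -> exists m (N : nat -> set R), (forall k, open (N k)) /\
    forall l, (m <= l)%N ->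
      (forall t, (forall k, (k <= l)%N -> N k (set_val t k)) -> O t) /\
      exists y : inverse_limit f,
        forall k, (k <= l)%N -> N (l - k)%N (set_val y k).
  move=> [A oA <-] Az.
  have [m [N [Nz NA]]] := nbhs_ptws_box _ _ _ (open_nbhs_nbhs (conj oA Az)).
  exists m, N; split=> [k|l ml]; [exact: (Nz k).1|split=> [t tN|]].
    by apply: NA => k km; apply: tN; exact: leq_trans ml.
  have /set_mem[zW zf] := valP z.
  have [y [y0 [y01 yf]]] := eventual_range_past _ _ _ Gf f01 (zW 0%N).
  (* [p] runs through [z] backwards from index [l] to 0, then follows the past [y]; the two join at
     [k = l], where [y 0 = z 0]. *)
  pose p k := if (k <= l)%N then set_val z (l - k)%N else y (k - l)%N.
  have pY : p \in inverse_limit f.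
    apply/mem_set; split=> k; rewrite /p.
      case: ifP => _; last exact: y01.
      by have [t _] := zW (l - k)%N 1%N isT; exact: f01.
    case: (ltngtP k l) => [kl|lk|->].
    - by rewrite -[(l - k)%N](subnSK kl); exact: zf.
    - by rewrite subSn ?(ltnW lk)//; exact: yf.
    - by rewrite subnn subSnn -[set_val z 0%N]y0; exact: yf.
  exists (exist _ p pY) => k kl; rewrite set_valE/= /p kl; exact: (Nz _).2.
have [m [M [oM MP]]] := reversal U x oU Ux.
have [n [N [oN NP]]] := reversal V x' oV Vx'.
(* A common length for both boxes lets the two occurrences overlap freely. *)
pose l := maxn m n.
have [MU [y yM]] := MP l (leq_maxl m n).
have [NV [y' yN]] := NP l (leq_maxr m n).
pose C (K : nat -> set R) : set (inverse_limit f) :=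
  set_val @^-1` [set z | forall k, (k <= l)%N -> K (l - k)%N (z k)].
have oC (K : nat -> set R) : (forall k, open (K k)) -> open (C K).
  by move=> oK; eexists; [exact: (open_ptws_box _ l (fun k => K (l - k)%N))|].
(* The shift moves into the past, so transitivity is applied with the cylinder for [V] first: [q]
   ends in [V]'s segment and, [d] steps earlier, passes through [U]'s. *)
have [d [_ [[q qN <-] qM]]] :
    exists d, (iter d (@inverse_limit_map R f) @` C N) `&` C M !=set0.
  by apply: trY; [exact: oC|exact: oC|exists y'|exists y].
have /set_mem qY := valP q; have [q01 qf] := qY.
(* A successor function, with default value 0 outside [[0, 1]]. *)
have /choice[s sP] : forall t, exists t', `[0, 1]%classic t -> f t t'.
  by move=> t; have [/f_total[t' ?]|?] := pselect (`[0, 1]%classic t);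
    [exists t'|exists 0].
(* [e] is the index in [q] of the earliest point of [U]'s segment; [z] reads [q] from there up to
   the present, index 0, then iterates [s]. *)
pose e := (d + l)%N.
pose z k := if (k <= e)%N then set_val q (e - k)%N
            else iter (k - e)%N s (set_val q 0%N).
have zE k : (k <= e)%N -> z k = set_val q (e - k)%N by rewrite /z => ->.
have zs k : (e <= k)%N -> z k.+1 = s (z k).
  move=> ek; rewrite /z ltnNge ek subSn//=.
  by case: (ltngtP k e) ek => // -> _; rewrite subnn.
have z0W : eventual_range f (z 0%N).
  by rewrite zE//; exact: inverse_limit_eventual_range.
have zP k : eventual_range f (z k) -> f (z k) (z k.+1).
  move=> Wz; have [ke|ek] := ltnP k e.
    by rewrite !zE ?(ltnW ke)// -(subnSK ke); exact: qf.
  rewrite zs//; apply: sP; have [t _] := Wz 1%N isT; exact: f01.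
have zW k : eventual_range f (z k).
  by elim: k => // k IH; apply: image_in_eventual_range (zP _ IH).
have zX : (z : {ptws nat -> R}) \in forward_trajectories f (eventual_range f).
  by apply/mem_set; split=> // k; exact: zP.
pose zz : forward_trajectories f (eventual_range f) :=
  exist (fun t => t \in forward_trajectories f (eventual_range f)) z zX.
exists d, (iter d (@forward_map R f (eventual_range f)) zz); split.
  exists zz => //; apply: MU => k kl; rewrite set_valE/=.
  have ke : (k <= e)%N by apply: leq_trans kl (leq_addl _ _).
  (* Coordinate [l - k] of the [d]-fold shift of [q] is [q] at [e - k], that is [z k]. *)
  have := qM (l - k)%N (leq_subr _ _).
  by rewrite subKn// iter_inverse_limit_map zE// /e addnC addnBA.
(* As [k + d <= e], the tail built with [s] is not reached, and [z (k + d)] is [q] at [l - k]. *)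
apply: NV => k kl; rewrite iter_forward_map set_valE/= zE; last first.
  by rewrite /e addnC leq_add2l.
have := qN (l - k)%N (leq_subr _ _); rewrite subKn//.
by rewrite /e [(k + d)%N]addnC subnDl.
Qed.

(** * Markov multi-maps as compact relations *)

(** A finite union of compact pieces: continuous images of segments for [mm_A0], products of a point
    with a segment, possibly degenerate, for the others. *)
Lemma compact_mm_graph (R : realType) (F : markov_multimap R) :
  compact (mm_graph F).
Proof.
rewrite /mm_graph (_ : [set: _] = [set` predT]); last by apply/seteqP; split.
rewrite bigcup_pred; apply: bigsetU_compact => -[[a|a]|a] _ /=.
- have -> : [set z | mm_D (inl (inl a)) z.1 /\ z.2 = mm_f a z.1] =
      (fun x => (x, mm_f a x)) @` mm_D (inl (inl a)).
    apply/seteqP; split=> [[x y] /= [Dx ->]|_ [x Dx <-]//].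
    by exists x.
  apply: continuous_compact.
    have [g [_ [cf _]]] := mm_fP a.
    have cid : {within mm_D (inl (inl a)), continuous (id : R -> R)}.
      by apply: continuous_subspaceT => x; exact: cvg_id.
    by move=> x; exact: (cvg_pair (cid x) (cf x)).
  by have [i _ ->] := mm_D0P a; exact: segment_compact.
- apply: compact_setX.
    by have [p _ ->] := mm_D1P a; exact: compact_set1.
  by have [u [v [_ _ _ -> _]]] := mm_R1P a; exact: segment_compact.
- apply: compact_setX.
    by have [p _ ->] := mm_D2P a; exact: compact_set1.
  by have [u _ ->] := mm_R2P a; exact: segment_compact.
Qed.

Lemma mm_P01 (R : realType) (F : markov_multimap R) :
  mm_P F `<=` `[0, 1]%classic.
Proof.
have mono i j : (i <= j)%N -> (j <= mm_r F)%N -> mm_pt F i <= mm_pt F j.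
  elim: j => [|j IH]; first by rewrite leqn0 => /eqP ->.
  rewrite leq_eqVlt => /orP[/eqP -> //|ij jr].
  by apply: le_trans (IH ij (ltnW jr)) (ltW (mm_pt_lt jr)).
move=> _ [i /= ir <-]; rewrite in_itv/= -(mm_pt_first F) -(mm_pt_last F).
by rewrite !mono.
Qed.

Lemma mm_val01 (R : realType) (F : markov_multimap R) x y :
  mm_val F x y -> `[0, 1]%classic y.
Proof.
have segR u v : mm_P F u -> mm_P F v -> `[u, v] `<=` `[0, 1]%classic.
  move=> /mm_P01 + /mm_P01; rewrite /= !in_itv/= => /andP[u0 _] /andP[_ v1] t.
  by rewrite /= !in_itv/= => /andP[/(le_trans u0)-> /le_trans->].
move=> [[[a|a]|a] _ /= [Dx]].
- move=> ->; have [g [[fR _ _ _] _]] := mm_fP a.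
  have [u [v [Pu Pv _ Ra]]] := mm_R0P a.
  by apply: (segR u v) => //; rewrite -Ra; exact: fR.
- by have [u [v [Pu Pv _ -> _]]] := mm_R1P a; exact: segR.
- by have [u Pu ->] := mm_R2P a; exact: segR.
Qed.

Lemma mm_val_total (R : realType) (F : markov_multimap R) x :
  `[0, 1]%classic x -> exists y, mm_val F x y.
Proof.
rewrite (mm_cover F) => -[[[a|a]|a] _ Dx].
- by exists (mm_f a x), (inl (inl a)).
- have [u [v [_ _ uv Ra _]]] := mm_R1P a.
  exists u, (inl (inr a)) => //; split=> //=.
  by rewrite Ra /= in_itv/= lexx ltW.
- have [u _ Ra] := mm_R2P a; exists u, (inr a) => //; split=> //=.
  by rewrite Ra /= in_itv/= lexx.
Qed.

Theorem proposition7p6 (R : realType) (F : markov_multimap R) :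
  properly_parametrized F ->
  topologically_transitive (@inverse_limit_map R (mm_val F)) ->
  topologically_transitive
    (@forward_map R (mm_val F) (eventual_range (mm_val F))).
Proof.
move=> _; apply: transitive_inverse_limit_forward.
- rewrite (_ : [set z | _] = mm_graph F); first exact: compact_mm_graph.
  by apply/seteqP; split=> -[].
- exact: mm_val01.
- exact: mm_val_total.
Qed.
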